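(* Let $A\in\{0,1\}^{N\times n}$ and write $m_\infty:=\mathsf{m}^{rd}(+\infty,A)$. For every $\epsilon>0$ there exists a constant $C_\epsilon=O(\epsilon^{-4})$, depending only on $\epsilon$, such that $$\mathsf{m}^{rd}\bigl(C_\epsilon\cdot m_\infty^{-2}\cdot\log(\min(n,N)),\,A\bigr)\ \ge\ (1-\epsilon)\,m_\infty .$$
   Context: For $A\in\{0,1\}^{N\times n}$, $m\ge 0$ and $\tau\in\mathbb{R}$, unit vectors $U_1,\dots,U_N\in\mathbb{R}^d$ and $V_1,\dots,V_n\in\mathbb{R}^d$ form a margin-$m$, relative-bias-$\tau$ embedding of $A$ in dimension $d$ if $\langle U_j,V_i\rangle\ge\tau+m$ whenever $A_{ji}=1$ and $\langle U_j,V_i\rangle\le\tau-m$ whenever $A_{ji}=0$. The quantity $\mathsf{m}^{rd}(d,A)$ is the supremum of all $m\ge 0$ for which a margin-$m$, relative-bias-$0$ embedding of $A$ in dimension $d$ exists ($-\infty$ if none exists), and $\mathsf{m}^{rd}(+\infty,A):=\sup_d\mathsf{m}^{rd}(d,A)$.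
   Formalization: The formal theorem assumes min(n,N) ≥ 2, since for min(n,N) = 1 the dimension C_ε·m_∞^{-2}·log 1 is 0, where no unit vectors exist and the claim fails; the dimension is rounded up to an integer. *)

(* Defs.v *)
From HB Require Import structures.
From mathcomp Require Import all_boot all_order all_algebra.
From mathcomp Require Import all_classical all_reals ereal exp.
Set Implicit Arguments. Unset Strict Implicit. Unset Printing Implicit Defensive.
Import Order.TTheory GRing.Theory Num.Theory.
Local Open Scope classical_set_scope.
Local Open Scope ring_scope.

Definition dotp (R : realType) (d : nat) (u v : 'rV[R]_d) : R :=
  \sum_(k < d) u ord0 k * v ord0 k.

Definition unit_vec (R : realType) (d : nat) (u : 'rV[R]_d) : Prop :=
  dotp u u = 1.

(* A 0/1 matrix A is a bool matrix; A j i = true means A_{ji} = 1.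
   Margin-m, relative-bias-tau embedding of A in dimension d. *)
Definition is_embedding (R : realType) (N n d : nat) (A : 'M[bool]_(N, n))
    (m tau : R) (U : 'I_N -> 'rV[R]_d) (V : 'I_n -> 'rV[R]_d) : Prop :=
  (forall j, unit_vec (U j)) /\ (forall i, unit_vec (V i)) /\
  (forall j i, if A j i then tau + m <= dotp (U j) (V i)
                         else dotp (U j) (V i) <= tau - m).

Definition margins (R : realType) (N n : nat) (d : nat) (A : 'M[bool]_(N, n))
  : set R :=
  [set m | 0 <= m /\ exists U V, @is_embedding R N n d A m 0 U V].

(* m^rd(d, A): supremum in the extended reals; -oo if no embedding exists. *)
Definition mrd (R : realType) (N n : nat) (d : nat) (A : 'M[bool]_(N, n))
  : \bar R :=
  ereal_sup [set (m%:E)%E | m in @margins R N n d A].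

Definition mrd_inf (R : realType) (N n : nat) (A : 'M[bool]_(N, n)) : \bar R :=
  ereal_sup [set @mrd R N n d A | d in [set: nat]].

(* Main.v *)
Require Import Defs.
From HB Require Import structures.
From mathcomp Require Import all_boot all_order all_algebra.
From mathcomp Require Import all_classical all_reals ereal exp.
From mathcomp Require Import sequences ring lra.
Import Order.TTheory GRing.Theory Num.Theory.
Local Open Scope ring_scope.

(* Transposing A, assume n <= N, and take an embedding (U, V) whose margin m
   is close to the supremum. Every sum S of k vectors +-V_i, signed according
   to a row j of A, satisfies |S| >= <U_j, S> >= k m. A Johnson-Lindenstrauss
   map P in dimension O(k log n / eps^2) preserves the norms of all (2n)^k
   signed k-fold sums of the V_i up to a factor 1 +- eps. If some row j had no
   unit vector with margin mu = (1 - O(eps)) m against the vectors P V_i, the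
   perceptron algorithm would produce a k-fold signed sum of the P V_i of norm
   at most mu k + O(sqrt k), which is less than (1 - eps) k m as soon as k is
   a large multiple of 1 / (eps m)^2: a contradiction. Only the n vectors V_i
   have to be projected, since the U_j are rebuilt in the target space; this
   is why min(n, N) is all that matters.

   The map P is a sign matrix, whose entries are chosen one after the other so
   that the expectation of an exponential potential does not increase. *)

(** * Choosing signs by averaging an exponential potential *)

Section SignSelection.
Set Implicit Arguments.
Unset Strict Implicit.
Variable R : realType.
Implicit Types (a h s x y : R).

Lemma expR_le_inv y : y < 1 -> expR y <= (1 - y)^-1.
Proof.
move=> y1; rewrite -[expR y]invrK -expRN lef_pV2 ?posrE ?expR_gt0 ?subr_gt0 //.
exact: expR_ge1Dx.
Qed.

(** The sharp constant in the exponent is 1/2; with 2, elementary bounds suffice. For small [y] the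
    left side is at most [2 / (1 - y ^+ 2)], and otherwise [|y| <= 2 * y ^+ 2]. *)
Lemma cosh_le_expR y : expR y + expR (- y) <= 2 * expR (2 * y ^+ 2).
Proof.
have [y2|y2] := leP (y ^+ 2) (1 / 2).
  have [y1 y1'] : y < 1 /\ - y < 1 by split; nra.
  have h1 := expR_le_inv y1; have h2 := expR_le_inv y1'.
  have h3 := expR_ge1Dx (2 * y ^+ 2).
  apply: (le_trans (lerD h1 h2)).
  apply: (@le_trans _ _ (2 * (1 + 2 * y ^+ 2))); last by rewrite ler_pM2l.
  rewrite opprK -(ler_pM2r (_ : 0 < (1 - y) * (1 + y))); last by nra.
  have -> : ((1 - y)^-1 + (1 + y)^-1) * ((1 - y) * (1 + y)) = 2.
    by field; apply/andP; split; apply/eqP; lra.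
  have -> : 2 * (1 + 2 * y ^+ 2) * ((1 - y) * (1 + y))
            = 2 + 2 * y ^+ 2 * (1 - 2 * y ^+ 2) by ring.
  rewrite lerDl; apply: mulr_ge0; last by lra.
  by rewrite mulr_ge0 ?sqr_ge0.
have h1 : expR y <= expR (2 * y ^+ 2).
  by rewrite ler_expR; have := sqr_ge0 (y - 1 / 2); nra.
have h2 : expR (- y) <= expR (2 * y ^+ 2).
  by rewrite ler_expR; have := sqr_ge0 (y + 1 / 2); nra.
lra.
Qed.

(** Once the squares are expanded, the sign of [x] affects only the cross term [2 * h * a * x],
    whose average is a hyperbolic cosine. *)
Lemma expR_sqr_sign_average h a x :
  expR (h * (a + x) ^+ 2) + expR (h * (a - x) ^+ 2)
  <= 2 * expR (h * x ^+ 2 + (h + 8 * h ^+ 2 * x ^+ 2) * a ^+ 2).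
Proof.
have -> : h * (a + x) ^+ 2 = h * (a ^+ 2 + x ^+ 2) + 2 * h * a * x by ring.
have -> : h * (a - x) ^+ 2 = h * (a ^+ 2 + x ^+ 2) + - (2 * h * a * x) by ring.
have -> : h * x ^+ 2 + (h + 8 * h ^+ 2 * x ^+ 2) * a ^+ 2 =
          h * (a ^+ 2 + x ^+ 2) + 2 * (2 * h * a * x) ^+ 2 by ring.
rewrite !(expRD (h * _)) -mulrDr [X in _ <= X]mulrCA ler_pM2l ?expR_gt0 //.
exact: cosh_le_expR.
Qed.

(** Induction step of [sign_row_exists] in the exponent: [s] is the squared length treated so far,
    [x] the next coordinate. Smallness gives [H ^+ 2 <= 2 * h ^+ 2], so the error
    [8 * H ^+ 2 * x ^+ 2] of one averaging fits into the increment [16 * h ^+ 2 * x ^+ 2]. *)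
Lemma sign_exponent_step h s x a H : H = h + 16 * h ^+ 2 * s ->
  0 <= s -> `|h| * (s + x ^+ 2) <= 1 / 48 ->
  H * s + (H * x ^+ 2 + (H + 8 * H ^+ 2 * x ^+ 2) * a ^+ 2) <=
  (h + 16 * h ^+ 2 * (s + x ^+ 2)) * (s + x ^+ 2 + a ^+ 2).
Proof.
move=> HE s0 hs.
have hs1 : `|h * s| <= 1 / 48.
  rewrite normrM (ger0_norm s0); apply: le_trans hs.
  by rewrite ler_wpM2l // lerDl sqr_ge0.
move: hs1; rewrite ler_norml => /andP[l1 l2].
have {}HE : H = h * (1 + 16 * (h * s)) by rewrite HE; ring.
have H2 : H ^+ 2 <= 2 * h ^+ 2.
  rewrite HE exprMn mulrC; apply: ler_wpM2r; [exact: sqr_ge0|nra].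
have HE' : h + 16 * h ^+ 2 * (s + x ^+ 2) = H + 16 * h ^+ 2 * x ^+ 2.
  by rewrite HE; ring.
have q : 0 <= h ^+ 2 * x ^+ 2 by rewrite mulr_ge0 ?sqr_ge0.
have q1 : H ^+ 2 * x ^+ 2 <= 2 * (h ^+ 2 * x ^+ 2).
  by rewrite mulrA; apply: ler_wpM2r => //; exact: sqr_ge0.
have q2 := sqr_ge0 x; have q3 := sqr_ge0 a.
rewrite HE' -subr_ge0.
have -> : (H + 16 * h ^+ 2 * x ^+ 2) * (s + x ^+ 2 + a ^+ 2) -
  (H * s + (H * x ^+ 2 + (H + 8 * H ^+ 2 * x ^+ 2) * a ^+ 2)) =
  16 * (h ^+ 2 * x ^+ 2) * (s + x ^+ 2) +
  8 * (2 * (h ^+ 2 * x ^+ 2) - H ^+ 2 * x ^+ 2) * a ^+ 2 by ring.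
rewrite -subr_ge0 in q1; apply: addr_ge0.
  by apply: mulr_ge0; [exact: mulr_ge0|exact: addr_ge0].
by apply: mulr_ge0 => //; exact: mulr_ge0.
Qed.

(** Method of conditional expectations for one row: the right side bounds the mean over random
    signs. The shift [a] collects the entries already fixed, and [h] may have either sign so as to
    serve both tails. *)
Lemma sign_row_exists (I : finType) (w h : I -> R) (x : I -> nat -> R) D :
  (forall c, 0 <= w c) ->
  (forall c, `|h c| * \sum_(k < D) x c k ^+ 2 <= 1 / 48) ->
  forall a : I -> R, exists r : nat -> R,
  \sum_c w c * expR (h c * (a c + \sum_(k < D) r k * x c k) ^+ 2) <=
  \sum_c w c * expR ((h c + 16 * h c ^+ 2 * \sum_(k < D) x c k ^+ 2) *
                     (\sum_(k < D) x c k ^+ 2 + a c ^+ 2)).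
Proof.
move=> w0; elim: D => [|D IH] hD a.
  exists (fun=> 0); apply: ler_sum => c _.
  by rewrite !big_ord0 addr0 mulr0 addr0 add0r.
have s0 c : 0 <= \sum_(k < D) x c k ^+ 2 by apply: sumr_ge0 => k _; exact: sqr_ge0.
have hD' c : `|h c| * \sum_(k < D) x c k ^+ 2 <= 1 / 48.
  apply: le_trans (hD c); rewrite ler_wpM2l //.
  by rewrite [leRHS]big_ord_recr /= lerDl sqr_ge0.
have [r1 h1] := IH hD' (fun c => a c + x c D).
have [r2 h2] := IH hD' (fun c => a c - x c D).
set T := \sum_c w c * _.
set F1 := (X in _ <= X) in h1; set F2 := (X in _ <= X) in h2.
(* [F1] and [F2] are the bounds left after fixing the last entry to 1 or -1; their mean is at most
   [T], so one of the two signs keeps the bound. *)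
have key : F1 + F2 <= 2 * T.
  rewrite -big_split mulr_sumr; apply: ler_sum => c _ /=.
  rewrite -mulrDr [leRHS]mulrCA ler_wpM2l //.
  set s := \sum_(k < D) x c k ^+ 2; set H := h c + _.
  rewrite ![in leLHS]mulrDr ![in leLHS]expRD -mulrDr.
  apply: (le_trans (ler_wpM2l (expR_ge0 _) (expR_sqr_sign_average _ _ _))).
  rewrite [leLHS]mulrCA ler_pM2l // -expRD ler_expR big_ord_recr /= -/s.
  apply: sign_exponent_step => //; first exact: s0.
  by have := hD c; rewrite big_ord_recr.
pose ext (r : nat -> R) e k := if k == D then e else r k.
have extE r e c : \sum_(k < D.+1) ext r e k * x c k =
    e * x c D + \sum_(k < D) r k * x c k.
  rewrite big_ord_recr /= /ext eqxx addrC; congr (_ + _).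
  by apply: eq_bigr => k _; rewrite ltn_eqF.
have [F1T|F1T] := leP F1 T.
  exists (ext r1 1); apply: le_trans F1T; apply: le_trans h1.
  by apply: ler_sum => c _; rewrite extE mul1r addrA.
exists (ext r2 (-1)); have F2T : F2 <= T by lra.
apply: le_trans F2T; apply: le_trans h2.
by apply: ler_sum => c _; rewrite extE mulN1r addrA.
Qed.

Lemma sign_matrix_exists (I : finType) (w h : I -> R) (x : I -> nat -> R) D d :
  (forall c, 0 <= w c) -> (forall c, `|h c| <= 1 / 48) ->
  (forall c, \sum_(k < D) x c k ^+ 2 = 1) ->
  exists r : nat -> nat -> R,
  \sum_c w c * expR (h c * \sum_(l < d) (\sum_(k < D) r l k * x c k) ^+ 2) <=
  \sum_c w c * expR (d%:R * (h c + 16 * h c ^+ 2)).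
Proof.
move=> w0 h48 x1; elim: d w w0 => [|d IH] w w0.
  exists (fun _ _ => 0); apply: ler_sum => c _.
  by rewrite big_ord0 mulr0 mul0r.
(* The earlier rows are chosen for weights that already carry the factor the last row will cost. *)
have [r hr] := IH (fun c => w c * expR (h c + 16 * h c ^+ 2))
  (fun c => mulr_ge0 (w0 c) (expR_ge0 _)).
have [||r' hr'] := @sign_row_exists I (fun c => w c *
   expR (h c * \sum_(l < d) (\sum_(k < D) r l k * x c k) ^+ 2)) h x D _ _ (fun=> 0).
- by move=> c; rewrite mulr_ge0 ?expR_ge0.
- by move=> c; rewrite x1 mulr1.
exists (fun l k => if l == d then r' k else r l k).
apply: le_trans (le_trans hr' _); last first.
  rewrite (le_trans _ (le_trans hr _)) //; apply: ler_sum => c _.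
    by rewrite x1 expr0n addr0 !mulr1 mulrAC.
  by rewrite -mulrA -expRD -(nat1r d) [in leRHS]mulrDl mul1r.
apply: ler_sum => c _; rewrite -mulrA -expRD -mulrDr add0r big_ord_recr /= eqxx.
under eq_bigr => l _ do (rewrite ltn_eqF //).
by [].
Qed.

End SignSelection.

(** * Inner products, Johnson-Lindenstrauss projection and the perceptron *)

Section Embeddings.
Set Implicit Arguments.
Unset Strict Implicit.
Variable R : realType.
Implicit Types (d n N : nat).

Lemma dotpC d (u v : 'rV[R]_d) : dotp u v = dotp v u.
Proof. by apply: eq_bigr => k _; rewrite mulrC. Qed.

Lemma dotpDl d (u v w : 'rV[R]_d) : dotp (u + v) w = dotp u w + dotp v w.
Proof. by rewrite /dotp -big_split; apply: eq_bigr => k _; rewrite mxE mulrDl. Qed.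

Lemma dotpZl d a (u v : 'rV[R]_d) : dotp (a *: u) v = a * dotp u v.
Proof. by rewrite /dotp mulr_sumr; apply: eq_bigr => k _; rewrite mxE mulrA. Qed.

Lemma dotpDr d (u v w : 'rV[R]_d) : dotp u (v + w) = dotp u v + dotp u w.
Proof. by rewrite dotpC dotpDl !(dotpC u). Qed.

Lemma dotpZr d a (u v : 'rV[R]_d) : dotp u (a *: v) = a * dotp u v.
Proof. by rewrite dotpC dotpZl dotpC. Qed.

Lemma dotp0r d (u : 'rV[R]_d) : dotp u 0 = 0.
Proof. by rewrite -(scale0r u) dotpZr mul0r. Qed.

Lemma dotp_ge0 d (u : 'rV[R]_d) : 0 <= dotp u u.
Proof. by apply: sumr_ge0 => k _; rewrite -expr2 sqr_ge0. Qed.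

Lemma dotp_sqr_le d (u v : 'rV[R]_d) : unit_vec u -> dotp u v ^+ 2 <= dotp v v.
Proof.
move=> u1; have := dotp_ge0 (v + (- dotp u v) *: u).
rewrite !dotpDl !dotpDr !dotpZl !dotpZr (dotpC v u) u1.
by move: (dotp u v) (dotp v v) => a b; rewrite -subr_ge0; nra.
Qed.

Lemma normalize_unit d (u : 'rV[R]_d) : 0 < dotp u u ->
  unit_vec ((Num.sqrt (dotp u u))^-1 *: u).
Proof.
move=> u0; rewrite /unit_vec dotpZl dotpZr mulrA -expr2 exprVn sqr_sqrtr ?ltW //.
by rewrite mulVf // gt_eqF.
Qed.

Lemma dotp_sum_sqr d (u : 'rV[R]_d) : dotp u u = \sum_(k < d) u ord0 k ^+ 2.
Proof. by []. Qed.

Lemma dotp_gt0 d (u : 'rV[R]_d) : u != 0 -> 0 < dotp u u.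
Proof.
move=> u0; rewrite lt_def dotp_ge0 andbT; apply: contra u0 => /eqP.
rewrite dotp_sum_sqr => /eqP; rewrite psumr_eq0 => [/allP z|k _]; last exact: sqr_ge0.
apply/eqP/rowP => k; rewrite mxE; apply/eqP.
by have := z k (mem_index_enum _); rewrite /= sqrf_eq0.
Qed.

(* Conditional expectations: the two tails of each vector are the summands of
   one exponential potential, which [sign_matrix_exists] keeps below 1. *)
Lemma sign_matrix_concentration (I : finType) (x : I -> nat -> R) D d (delta : R) :
  0 < delta <= 1 / 2 ->
  (forall c, \sum_(k < D) x c k ^+ 2 = 1) ->
  2 * #|I|%:R * expR (- (d%:R * delta ^+ 2 / 64)) < 1 ->
  exists r : nat -> nat -> R, forall c,
    (1 - delta) * d%:R <= \sum_(l < d) (\sum_(k < D) r l k * x c k) ^+ 2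
      <= (1 + delta) * d%:R.
Proof.
move=> /andP[delta0 delta1] x1 small.
pose sg (b : bool) : R := if b then 1 else -1.
(* The boolean selects the tail. The rate [delta / 32] minimizes [16 * h ^+ 2 - h * delta], with
   value [- delta ^+ 2 / 64]; [w] is normalized so that a vector in a tail has a summand of at least
   1. *)
pose h (c : I * bool) := sg c.2 * (delta / 32).
pose w (c : I * bool) := expR (- h c * ((1 + sg c.2 * delta) * d%:R)).
have sgn b : `|sg b| = 1 by case: b; rewrite /= ?normrN1 ?normr1.
have sg2 b : sg b ^+ 2 = 1 by case: b; rewrite /= ?sqrrN expr1n.
have [c|c|c|r hr] := @sign_matrix_exists R _ w h (fun c => x c.1) D d.
- exact: expR_ge0.
- by rewrite /h normrM sgn mul1r ger0_norm; lra.
- exact: x1.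
have lt1 : \sum_c w c * expR (h c * \sum_(l < d) (\sum_(k < D) r l k * x c.1 k) ^+ 2) < 1.
  apply: le_lt_trans hr _; apply: le_lt_trans small.
  rewrite (eq_bigr (fun=> expR (- (d%:R * delta ^+ 2 / 64)))) => [|c _].
    by rewrite sumr_const card_prod card_bool -[leLHS]mulr_natl natrM
      [_%:R * 2%:R]mulrC.
  rewrite /w -expRD; congr expR; rewrite /h.
  have := sg2 c.2; move: (sg c.2) => e e2.
  rewrite [(e * _) ^+ 2]exprMn e2.
  have -> : - (e * (delta / 32)) * ((1 + e * delta) * d%:R) =
    - (d%:R * (delta / 32) * (e + e ^+ 2 * delta)) by ring.
  by rewrite e2; field.
exists r => c; set Q := \sum_(l < d) _.
have bnd b : expR (h (c, b) * (Q - (1 + sg b * delta) * d%:R)) < 1.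
  apply: le_lt_trans lt1.
  rewrite (bigD1 (c, b)) //= -expRD.
  have -> : h (c, b) * (Q - (1 + sg b * delta) * d%:R) =
    - h (c, b) * ((1 + sg b * delta) * d%:R) + h (c, b) * Q by ring.
  rewrite lerDl; apply: sumr_ge0 => c' _; exact: mulr_ge0 (expR_ge0 _) (expR_ge0 _).
have := bnd true; have := bnd false; rewrite !expR_lt1 /h /= => b1 b2.
by apply/andP; split; nra.
Qed.

Lemma johnson_lindenstrauss (I : finType) D (y : I -> 'rV[R]_D) d (delta : R) :
  0 < delta <= 1 / 2 ->
  2 * #|I|%:R * expR (- (d%:R * delta ^+ 2 / 64)) < 1 ->
  exists P : 'M[R]_(D, d), forall c,
    (1 - delta) * dotp (y c) (y c) <= dotp (y c *m P) (y c *m P)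
      <= (1 + delta) * dotp (y c) (y c).
Proof.
move=> hdelta small.
pose J := {c : I | y c != 0}.
pose z (c : J) := (Num.sqrt (dotp (y (val c)) (y (val c))))^-1 *: y (val c).
pose x (c : J) (k : nat) := oapp (z c ord0) 0 (insub k).
have xE c (k : 'I_D) : x c k = z c ord0 k by rewrite /x valK.
have [c||r hr] := @sign_matrix_concentration J x D d delta hdelta.
- rewrite -(normalize_unit (dotp_gt0 (valP c))) dotp_sum_sqr.
  by apply: eq_bigr => k _; rewrite xE.
- apply: le_lt_trans small; rewrite ler_pM2r ?expR_gt0 // ler_pM2l // ler_nat.
  by rewrite card_sig max_card.
pose P : 'M[R]_(D, d) := \matrix_(k, l) ((Num.sqrt d%:R)^-1 * r l k).
exists P => c.
(* For [d = 0] the hypothesis [small] would make [I] empty, but [c] lies in it. *)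
have d0 : 0 < d%:R :> R.
  rewrite ltr0n lt0n; apply/eqP => d0; move: small.
  rewrite d0 !mul0r oppr0 expR0 mulr1 -natrM ltrn1 ltnS leqn0 muln_eq0 /=.
  by rewrite -leqn0 leqNgt => /negP; apply; apply/card_gt0P; exists c.
have [yc0|yc0] := eqVneq (y c) 0; first by rewrite yc0 mul0mx !dotp0r !mulr0 lexx.
have nc := dotp_gt0 yc0; set q := dotp (y c) (y c) in nc *.
have := hr (Sub c yc0); set Q := \sum_(l < d) _ => hQ.
have -> : dotp (y c *m P) (y c *m P) = Q / d%:R * q.
  rewrite dotp_sum_sqr /Q !mulr_suml; apply: eq_bigr => l _.
  rewrite -[d%:R in RHS]sqr_sqrtr ?ltW // -[q]sqr_sqrtr ?ltW //.
  rewrite -exprVn -!exprMn; congr (_ ^+ 2).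
  rewrite mxE !mulr_suml; apply: eq_bigr => k _.
  rewrite xE !mxE /= -/q; field.
  by rewrite !sqrtr_eq0 -!ltNge nc d0.
by rewrite !ler_pM2r // ler_pdivlMr // ler_pdivrMr.
Qed.

(* If no unit vector has margin [mu], then each partial sum has a successor
   whose inner product with it is small, and the norms of these sums grow
   like those of an orthogonal sequence drifting at speed [mu]. *)
Lemma perceptron d (T : Type) (y : T -> 'rV[R]_d) (mu B : R) (t0 : T) :
  0 <= mu -> 0 <= B -> (forall t, dotp (y t) (y t) <= B ^+ 2) ->
  (exists u, unit_vec u /\ forall t, mu <= dotp u (y t)) \/
  (forall k, exists l : k.-tuple T,
     dotp (\sum_(t <- l) y t) (\sum_(t <- l) y t)
     <= (mu * k%:R + B * Num.sqrt k%:R) ^+ 2).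
Proof.
move=> mu0 B0 yB; have [|nou] := pselect (exists u : 'rV[R]_d,
  unit_vec u /\ forall t, mu <= dotp u (y t)); first by left.
right; have next S : exists t, dotp S (y t) <= mu * Num.sqrt (dotp S S).
  have [->|S0] := eqVneq S 0.
    by exists t0; rewrite dotpC !dotp0r sqrtr0 mulr0.
  have nS : 0 < Num.sqrt (dotp S S) by rewrite sqrtr_gt0 dotp_gt0.
  apply: contrapT => /forallNP hS; apply: nou.
  exists ((Num.sqrt (dotp S S))^-1 *: S); split; first exact/normalize_unit/dotp_gt0.
  move=> t; rewrite dotpZl mulrC ler_pdivlMr //.
  by move: (hS t) => /negP; rewrite -ltNge => /ltW.
elim=> [|k [l hl]].
  by exists [tuple]; rewrite big_nil dotp0r sqr_ge0.
set S := \sum_(t <- l) y t in hl.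
have [t ht] := next S; exists [tuple of t :: l]; rewrite big_cons -/S.
rewrite !dotpDl !dotpDr (dotpC (y t) S).
have A0 : 0 <= mu * k%:R + B * Num.sqrt k%:R.
  by rewrite addr_ge0 // mulr_ge0 // sqrtr_ge0.
have hS : Num.sqrt (dotp S S) <= mu * k%:R + B * Num.sqrt k%:R.
  by rewrite -(ger0_norm A0) -sqrtr_sqr ler_wsqrtr.
have {ht}ht := le_trans ht (ler_wpM2l mu0 hS).
have hpq : Num.sqrt k%:R <= Num.sqrt k.+1%:R :> R by rewrite ler_wsqrtr // ler_nat.
have hp : Num.sqrt k%:R ^+ 2 = k%:R :> R by rewrite sqr_sqrtr.
have hq : Num.sqrt k.+1%:R ^+ 2 = k.+1%:R :> R by rewrite sqr_sqrtr.
have tB := yB t; have k0 := ler0n R k.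
move: hl ht tB hp hq hpq k0; rewrite -(natr1 k) {A0 hS}.
move: k%:R (Num.sqrt k%:R) (Num.sqrt (k%:R + 1)).
move: (dotp S S) (dotp S (y t)) (dotp (y t) (y t)) => a b c K p q hl ht tB hp hq hpq k0.
(* The slack of the induction step is [mu ^+ 2] plus twice this quantity. *)
have gap : 0 <= mu * B * (K + 1) * (q - p).
  by rewrite !mulr_ge0 ?subr_ge0 // addr_ge0.
have mu2 := sqr_ge0 mu.
have E1 : (mu * (K + 1) + B * q) ^+ 2 = mu ^+ 2 * (K + 1) ^+ 2 +
  2 * (mu * B * (K + 1) * q) + B ^+ 2 * (K + 1) by rewrite -hq; ring.
have E2 : (mu * K + B * p) ^+ 2 = mu ^+ 2 * K ^+ 2 +
  2 * (mu * B * K * p) + B ^+ 2 * K by rewrite -hp; ring.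
rewrite E1; rewrite E2 in hl; lra.
Qed.

(** * Rebuilding an embedding from projected vectors *)

Lemma project_embedding N n D d (A : 'M[bool]_(N, n)) (m mu delta : R) k
    (U : 'I_N -> 'rV[R]_D) (V : 'I_n -> 'rV[R]_D) :
  is_embedding A m 0 U V -> (0 < n)%N -> (0 < k)%N -> 0 <= m -> 0 <= mu ->
  0 < delta <= 1 / 2 ->
  2 * ((2 * n) ^ k)%:R * expR (- (d%:R * delta ^+ 2 / 64)) < 1 ->
  mu * k%:R + 2 * Num.sqrt k%:R < (1 - delta) * m * k%:R ->
  @margins R N n d A (mu * (1 - delta)).
Proof.
move=> [U1 [V1 UV]] n0 k0 m0 mu0 hdelta small gap.
pose sg (b : bool) : R := if b then 1 else -1.
have sgg b : sg b * sg b = 1 by case: b; rewrite /sg ?mulrNN mulr1.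
(* All sign patterns are included, so the [(2 * n) ^ k] sums serve every row of [A] at once,
   whatever [N] is. *)
pose comb (l : k.-tuple ('I_n * bool)) := \sum_(p <- l) sg p.2 *: V p.1.
have [|P hP] := @johnson_lindenstrauss (k.-tuple ('I_n * bool)) D comb d delta hdelta.
  by rewrite card_tuple card_prod card_ord card_bool mulnC.
have /andP[delta0 delta1] := hdelta.
have kR : 0 < k%:R :> R by rewrite ltr0n.
pose x i := V i *m P.
(* A constant tuple gives [k%:R *: V i], so the single vectors are nearly preserved too. *)
have hx i : (1 - delta) <= dotp (x i) (x i) <= (1 + delta).
  have := hP [tuple of nseq k (i, true)].
  have -> : comb [tuple of nseq k (i, true)] = k%:R *: V i.
    rewrite /comb /=; elim: (k) => [|k' IH]; first by rewrite big_nil scale0r.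
    by rewrite /= big_cons IH /= scale1r -nat1r scalerDl scale1r.
  rewrite -scalemxAl !dotpZl !dotpZr V1 -/(x i) => /andP[h1 h2].
  have kk : 0 < k%:R * k%:R :> R by exact: mulr_gt0.
  by apply/andP; split; rewrite -(ler_pM2r kk); lra.
have x0 i : 0 < dotp (x i) (x i) by case/andP: (hx i) => h _; lra.
(* The perceptron runs with norm bound 2, since [1 + delta <= 2 ^+ 2]. Its short sum, with indices
   tagged by row [j], is the image of some [comb l'], and [U j] forces that sum to be long. *)
have hU j : exists u, unit_vec u /\ forall i, mu <= dotp u (sg (A j i) *: x i).
  have [||i|//|/(_ k)[l hl]] := @perceptron d 'I_n (fun i => sg (A j i) *: x i) mu 2
    (Ordinal n0) => //.
    rewrite dotpZl dotpZr mulrA; case/andP: (hx i) => _ h.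
    by rewrite sgg mul1r; lra.
  exfalso; move: gap; apply/negP; rewrite -leNgt.
  pose l' := map_tuple (fun i => (i, A j i)) l.
  have cE : comb l' = \sum_(i <- l) sg (A j i) *: V i by rewrite /comb big_map.
  have PE : comb l' *m P = \sum_(i <- l) sg (A j i) *: x i.
    by rewrite cE mulmx_suml; apply: eq_bigr => i _; rewrite -scalemxAl.
  have km : m * k%:R <= dotp (U j) (comb l').
    have -> : dotp (U j) (comb l') = \sum_(i <- l) sg (A j i) * dotp (U j) (V i).
      rewrite cE; elim: (val l) => [|i s IH]; first by rewrite !big_nil dotp0r.
      by rewrite !big_cons dotpDr dotpZr IH.
    have -> : m * k%:R = \sum_(i <- l) m.
      by rewrite big_const_seq count_predT size_tuple iter_addr_0 mulr_natr.
    apply: ler_sum => i _; have := UV j i; rewrite /sg; case: (A j i); lra.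
  have km0 : 0 <= m * k%:R by rewrite mulr_ge0.
  have norm_l : (m * k%:R) ^+ 2 <= dotp (comb l') (comb l').
    by apply: le_trans (dotp_sqr_le _ (U1 j)); rewrite lerXn2r // nnegrE (le_trans km0).
  have /andP[hlow _] := hP l'; rewrite PE in hlow.
  have sq : ((1 - delta) * m * k%:R) ^+ 2 <= (mu * k%:R + 2 * Num.sqrt k%:R) ^+ 2.
    apply: le_trans hl; apply: le_trans hlow.
    rewrite -mulrA exprMn; apply: (@le_trans _ _ ((1 - delta) * (m * k%:R) ^+ 2)).
      by rewrite ler_wpM2r ?sqr_ge0 //; nra.
    by rewrite ler_wpM2l //; lra.
  have := sqrtr_ge0 (k%:R : R) => s0.
  move: sq; rewrite ler_sqr // ?nnegrE.
    by rewrite !mulr_ge0 //; lra.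
  by rewrite addr_ge0 // mulr_ge0.
have [u hu] := choice hU.
split; first by rewrite mulr_ge0 //; lra.
exists u, (fun i => (Num.sqrt (dotp (x i) (x i)))^-1 *: x i).
split; first by move=> j; case: (hu j).
split; first by move=> i; exact: normalize_unit.
move=> j i; rewrite dotpZr.
have ns : 0 < Num.sqrt (dotp (x i) (x i)) by rewrite sqrtr_gt0.
have ns1 : Num.sqrt (dotp (x i) (x i)) <= 1 + delta.
  have p : 0 <= 1 + delta by lra.
  rewrite -(ger0_norm p) -sqrtr_sqr ler_wsqrtr //.
  case/andP: (hx i) => _ h; nra.
(* Normalizing the projected vectors costs the last factor [1 - delta] of the margin. *)
have inv1 : 1 - delta <= (Num.sqrt (dotp (x i) (x i)))^-1.
  rewrite -[leRHS]mul1r ler_pdivlMr //.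
  have : (1 - delta) * Num.sqrt (dotp (x i) (x i)) <= (1 - delta) * (1 + delta).
    by rewrite ler_wpM2l //; lra.
  by have := sqr_ge0 delta; nra.
have [_ /(_ i)] := hu j; rewrite dotpZr /sg => hmu.
have {}hmu : mu * (1 - delta) <=
   (Num.sqrt (dotp (x i) (x i)))^-1 * (sg (A j i) * dotp (u j) (x i)).
  by rewrite mulrC; apply: ler_pM => //; lra.
by move: hmu; rewrite /sg; case: (A j i); rewrite ?mul1r ?mulN1r ?mulrN; lra.
Qed.

(** * Transposition and a priori bounds on margins *)

Lemma margins_tr N n d (A : 'M[bool]_(N, n)) :
  @margins R n N d A^T = @margins R N n d A.
Proof.
have half N' n' (A' : 'M[bool]_(N', n')) m :
    @margins R N' n' d A' m -> @margins R n' N' d A'^T m.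
  move=> [m0 [U [V [U1 [V1 UV]]]]]; split=> //; exists V, U; split=> //; split=> //.
  by move=> j i; rewrite mxE dotpC; exact: UV.
apply/seteqP; split=> m; last exact: half.
by move/half; rewrite trmxK.
Qed.

Lemma mrd_tr N n d (A : 'M[bool]_(N, n)) : @mrd R n N d A^T = @mrd R N n d A.
Proof. by rewrite /mrd margins_tr. Qed.

Lemma mrd_inf_tr N n (A : 'M[bool]_(N, n)) : @mrd_inf R n N A^T = @mrd_inf R N n A.
Proof.
rewrite /mrd_inf; congr ereal_sup.
by apply/seteqP; split=> _ [d _ <-]; exists d; rewrite ?mrd_tr.
Qed.

Lemma margins_le_mrd_inf N n d (A : 'M[bool]_(N, n)) (m : R) :
  @margins R N n d A m -> (m%:E <= mrd_inf R A)%E.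
Proof.
move=> hm; apply: (@le_trans _ _ (mrd R d A)).
  by apply: ereal_sup_ubound; exists m.
by apply: ereal_sup_ubound; exists d.
Qed.

Lemma lt_mrd_inf_margins N n (A : 'M[bool]_(N, n)) (a : R) :
  (a%:E < mrd_inf R A)%E -> exists d m, @margins R N n d A m /\ a < m.
Proof.
move=> /ereal_sup_gt[_ [d _ <-]] /ereal_sup_gt[_ [m hm <-]].
by rewrite lte_fin => am; exists d, m.
Qed.

Lemma margins_le1 N n d (A : 'M[bool]_(N, n)) (m : R) :
  (0 < N)%N -> (0 < n)%N -> @margins R N n d A m -> m <= 1.
Proof.
move=> N0 n0 [m0 [U [V [U1 [V1 UV]]]]].
have := UV (Ordinal N0) (Ordinal n0).
have := dotp_sqr_le (V (Ordinal n0)) (U1 (Ordinal N0)); rewrite V1.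
move: (dotp _ _) => a; case: (A _ _); nra.
Qed.

(** Normalized sign rows are paired with the standard basis. This makes the supremum positive, so
    that dividing by its square is meaningful. *)
Lemma margins_sign_rows N n (A : 'M[bool]_(N, n)) : (0 < n)%N ->
  @margins R N n n A (Num.sqrt n%:R)^-1.
Proof.
move=> n0; have s0 : 0 < Num.sqrt n%:R :> R by rewrite sqrtr_gt0 ltr0n.
split; first by rewrite invr_ge0 ltW.
exists (fun j => \row_i (if A j i then (Num.sqrt n%:R)^-1 else - (Num.sqrt n%:R)^-1)).
exists (fun i => \row_l (l == i)%:R).
have E (w : 'rV[R]_n) i : dotp w (\row_l (l == i)%:R) = w ord0 i.
  rewrite /dotp (bigD1 i) //= mxE eqxx mulr1 big1 ?addr0 // => l /negPf li.
  by rewrite mxE li mulr0.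
split=> [j|].
  rewrite /unit_vec dotp_sum_sqr (eq_bigr (fun=> n%:R^-1)) => [|i _].
    by rewrite sumr_const card_ord -[LHS]mulr_natl divff // pnatr_eq0 -lt0n.
  by rewrite mxE; case: ifP; rewrite ?sqrrN exprVn sqr_sqrtr.
split=> [i|j i]; first by rewrite /unit_vec E mxE eqxx.
by rewrite E mxE; case: (A j i); rewrite ?add0r ?sub0r.
Qed.

Lemma mrd_ge_columns N n d (A : 'M[bool]_(N, n)) (e M : R) :
  (1 < n)%N -> (0 < N)%N -> 0 < e <= 1 / 2 -> mrd_inf R A = M%:E ->
  450 ^+ 2 / e ^+ 4 * M ^- 2 * ln n%:R <= d%:R ->
  (((1 - e) * M)%:E <= mrd R d A)%E.
Proof.
move=> n1 N0 /andP[e0 e1] AM dge; have n0 : (0 < n)%N by exact: ltnW.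
have M0 : 0 < M.
  have := margins_le_mrd_inf (margins_sign_rows A n0); rewrite AM lee_fin.
  by apply: lt_le_trans; rewrite invr_gt0 sqrtr_gt0 ltr0n.
have M1 : M <= 1.
  rewrite leNgt; apply/negP => M1.
  have [|d' [m' [hm']]] := @lt_mrd_inf_margins N n A 1; first by rewrite AM lte_fin.
  by rewrite ltNge (margins_le1 N0 n0 hm').
have [|D [m [[m0 [U [V UV]]] mM]]] := @lt_mrd_inf_margins N n A ((1 - e / 4) * M).
  by rewrite AM lte_fin gtr_pMl //; lra.
pose X := ((e * M) ^+ 2)^-1.
have eM0 : 0 < e * M by exact: mulr_gt0.
have X1 : 1 <= X.
  rewrite /X -[leRHS]mul1r ler_pdivlMr ?exprn_gt0 // mul1r expr_le1 ?(ltW eM0) //.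
  by have := ler_wpM2l (ltW e0) M1; lra.
(* The factor 64 yields [8 < e * M * Num.sqrt k%:R] below; rounding up costs at most [X], because
   [1 <= X]. *)
pose k := (Num.truncn (64 * X)).+1.
have kX : 64 * X < k%:R by exact: truncnS_gt.
have kle : k%:R <= 65 * X.
  have : (Num.truncn (64 * X))%:R <= 64 * X by rewrite truncn_le; lra.
  by rewrite /k -natr1; lra.
have L2 : ln 2 <= ln n%:R :> R by rewrite ler_ln ?posrE ?ltr0n ?ler_nat.
have L0 : 0 < ln n%:R :> R by apply: ln_gt0; rewrite ltr1n.
(* Parameters: [delta = e / 4] and [mu = (1 - 3 / 4 * e) * M]; the product
   [(1 - 3 / 4 * e) * (1 - e / 4)] is at least [1 - e]. *)
apply: (@le_trans _ _ ((1 - 3 / 4 * e) * M * (1 - e / 4))%:E); last first.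
  apply: ereal_sup_ubound; exists ((1 - 3 / 4 * e) * M * (1 - e / 4)) => //.
  apply: (project_embedding UV n0 (ltn0Sn _ : (0 < k)%N) m0).
  - by rewrite mulr_ge0 ?ltW //; lra.
  - by apply/andP; split; lra.
  - have E : 2 * ((2 * n) ^ k)%:R = expR (ln 2 + k%:R * (ln 2 + ln n%:R)) :> R.
      by rewrite expRD expRM_natl expRD !lnK ?posrE ?ltr0n // natrX natrM.
    rewrite E -expRD expR_lt1.
    have kL : k%:R * (ln 2 + ln n%:R) <= 65 * X * (2 * ln n%:R) :> R.
      by apply: ler_pM => //; have := ln_gt0 (ltr1n R 2); lra.
    have XL : ln n%:R <= X * ln n%:R by rewrite ler_peMl // ltW.
    (* The union bound costs at most [131 * (X * ln n%:R)], while [450 ^+ 2 / 1024] exceeds 197. *)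
    have : d%:R * (e / 4) ^+ 2 / 64 >= 450 ^+ 2 / 1024 * (X * ln n%:R).
      have -> : 450 ^+ 2 / 1024 * (X * ln n%:R) =
         450 ^+ 2 / e ^+ 4 * M ^- 2 * ln n%:R * ((e / 4) ^+ 2 / 64).
        by rewrite /X; field; rewrite !gt_eqF.
      by rewrite -[leRHS]mulrA ler_pM2r // divr_gt0 // exprn_gt0 // divr_gt0.
    lra.
  - have p2 : Num.sqrt k%:R ^+ 2 = k%:R :> R by rewrite sqr_sqrtr.
    have p0 : 0 < Num.sqrt k%:R :> R by rewrite sqrtr_gt0 ltr0n.
    (* Equivalently, the perceptron error [2 * Num.sqrt k%:R] is below [e / 4 * M * k%:R], which
       leaves [(1 - e / 2) * M * k%:R] in total. *)
    have big : 8 < e * M * Num.sqrt k%:R.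
      rewrite -(ltr_sqr) ?nnegrE ?mulr_ge0 ?ltW // exprMn p2.
      rewrite -(@ltr_pM2l _ ((e * M) ^+ 2)) ?exprn_gt0 // in kX.
      apply: le_lt_trans kX; rewrite mulrCA /X divff ?gt_eqF ?exprn_gt0 //; lra.
    have step : (1 - e / 2) * M * k%:R <= (1 - e / 4) * m * k%:R.
      rewrite ler_wpM2r //; apply: (@le_trans _ _ ((1 - e / 4) * ((1 - e / 4) * M))).
        by have := mulr_ge0 (sqr_ge0 e) (ltW M0); lra.
      by rewrite ler_wpM2l ?ltW //; lra.
    apply: lt_le_trans step.
    by rewrite -(ltr_pM2r p0) -[ltRHS]mulrA -expr2 p2 in big; lra.
by rewrite lee_fin; have := mulr_ge0 (sqr_ge0 e) (ltW M0); lra.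
Qed.

End Embeddings.

Theorem theorem1p4 (R : realType) :
  exists C : R -> R,
    (exists K eps0 : R, 0 < K /\ 0 < eps0 /\
       forall eps : R, 0 < eps < eps0 -> C eps <= K / eps ^+ 4) /\
    forall eps : R, 0 < eps ->
      0 < C eps /\
      forall (N n : nat) (A : 'M[bool]_(N, n)) (minf : R),
        (2 <= minn n N)%N ->
        @mrd_inf R N n A = minf%:E ->
        (((1 - eps) * minf)%:E <=
           @mrd R N n (absz (Num.ceil (C eps * minf ^-2 * ln (minn n N)%:R))) A)%E.
Proof.
(* Capping [eps] at 1/2 meets the range of [mrd_ge_columns]; since the supremum is nonnegative, the
   smaller value gives a stronger bound. *)
exists (fun eps => 450 ^+ 2 / Num.min eps (1 / 2) ^+ 4); split.
  exists (450 ^+ 2), (1 / 2); split; first by lra.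
  split=> [|eps /andP[_ /ltW eps2]]; first by lra.
  by rewrite (min_idPl eps2).
move=> eps eps0; set e := Num.min _ _.
have he : 0 < e <= 1 / 2 by rewrite /e lt_min eps0 ge_min lexx orbT /= andbT; lra.
have /andP[e0 _] := he.
split=> [|N n A M]; first by rewrite divr_gt0 ?exprn_gt0.
rewrite leq_min => /andP[n2 N2] AM; set d := absz _.
have dge : 450 ^+ 2 / e ^+ 4 * M ^- 2 * ln (minn n N)%:R <= d%:R.
  by rewrite natr_absz (le_trans (ceil_ge _)) // ler_int ler_norm.
have M0 : 0 <= M.
  have := margins_le_mrd_inf (margins_sign_rows R A (ltnW n2)); rewrite AM lee_fin.
  by apply: le_trans; rewrite invr_ge0 sqrtr_ge0.
apply: (@le_trans _ _ ((1 - e) * M)%:E).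
  by rewrite lee_fin ler_wpM2r // lerB // /e ge_min lexx.
have [nN|/ltnW Nn] := leqP n N.
  by apply: mrd_ge_columns => //; [exact: ltnW|move: dge; rewrite (minn_idPl nN)].
rewrite -mrd_tr; apply: mrd_ge_columns => //; first exact: ltnW.
  by rewrite mrd_inf_tr.
by move: dge; rewrite (minn_idPr Nn).
Qed.
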